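(* Let $\Gamma\curvearrowright X$ be a topologically free action of an infinite amenable group on the Cantor set. Then every subgroup $G$ of the topological full group $[[\Gamma\curvearrowright X]]$ containing the alternating group $\mathsf{A}(\Gamma,X)$ is inner amenable.
   Context: Acting groups are discrete and act by homeomorphisms. An action is topologically free if the set of points with trivial stabilizer is dense. For an action $\Gamma\curvearrowright X$, written $(s,x)\mapsto sx$, the topological full group $[[\Gamma\curvearrowright X]]$ is the group of all homeomorphisms $T:X\to X$ for which there exist a clopen partition $\{P_1,\dots,P_n\}$ of $X$ and $s_1,\dots,s_n\in\Gamma$ such that $Tx=s_ix$ for every $i$ and every $x\in P_i$. The alternating group $\mathsf{A}(\Gamma,X)$ is the subgroup of $[[\Gamma\curvearrowright X]]$ generated by the images $\varphi(\mathsf{A}_3)$ of the alternating group $\mathsf{A}_3$ on $\{1,2,3\}$, where $\varphi$ ranges over all group homomorphisms from the symmetric group $\mathsf{S}_3$ to $[[\Gamma\curvearrowright X]]$ for which there are pairwise disjoint clopen sets $A_1,A_2,A_3\subseteq X$ such that for every $\sigma\in\mathsf{S}_3$ the homeomorphism $\varphi(\sigma)$ is the identity off $A_1\sqcup A_2\sqcup A_3$ and, for each $i=1,2,3$, acts on $A_i$ as some element of $\Gamma$ with image $A_{\sigma(i)}$. A mean on a set is a finitely additive probability measure defined on all of its subsets. A discrete group $G$ is inner amenable if there exists a conjugation-invariant mean $m$ on $G$ which is atomless, i.e., $m(F)=0$ for every finite $F\subseteq G$. *)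

(* Defs.v *)
From HB Require Import structures.
From mathcomp Require Import all_boot all_order all_algebra.
From mathcomp Require Import perm alt.
From mathcomp Require Import all_classical all_reals.
From mathcomp Require Import all_analysis.

Set Implicit Arguments.
Unset Strict Implicit.
Unset Printing Implicit Defensive.

Import Order.TTheory GRing.Theory Num.Theory.

Local Open Scope classical_set_scope.
Local Open Scope ring_scope.

Section Means.
Variable R : realType.

Definition is_mean (T : Type) (m : set T -> R) : Prop :=
  [/\ forall A, 0 <= m A,
      m [set: T] = 1 &
      forall A B, A `&` B = set0 -> m (A `|` B) = m A + m B].

Definition amenable (H : groupType) : Prop :=
  exists m : set H -> R, is_mean m /\
    forall (g : H) (A : set H), m [set (g * x)%g | x in A] = m A.

Definition inner_amenable (H : groupType) : Prop :=
  exists m : set H -> R,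
    [/\ is_mean m,
        forall (g : H) (A : set H), m [set (g * x * g^-1)%g | x in A] = m A &
        forall F : set H, finite_set F -> m F = 0].

End Means.

Definition subgroup_type (H : groupType) (G : groupClosed H) : Type :=
  {x : H | x \in G}.

Section SubgroupType.
Variables (H : groupType) (G : groupClosed H).

HB.instance Definition _ := SubChoice.on (subgroup_type G).
HB.instance Definition _ :=
  SubChoice_isSubGroup.Build H _ (subgroup_type G) 
    (conj (@gpred1 H G) (@gpredF H G)).
End SubgroupType.

Definition generated_subgroup (H : groupType) (S : set H) : set H :=
  smallest [set K : set H | group_closed (mem K)] S.

Record homeo (X : topologicalType) := Homeo {
  homeo_fun :> X -> X;
  homeo_inv : X -> X;
  homeo_funK : cancel homeo_fun homeo_inv;
  homeo_invK : cancel homeo_inv homeo_fun;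
  homeo_continuous : continuous homeo_fun;
  homeo_inv_continuous : continuous homeo_inv }.

Section HomeoGroup.
Variable X : topologicalType.
Implicit Types f g h : homeo X.

Lemma homeo_eq f g : f =1 g -> f = g.
Proof.
case: f g => [f f' fK f'K fc f'c] [g g' gK g'K gc g'c] /= /funext fg.
have fg' : f' = g'.
  by apply/funext => x; rewrite -[in LHS](g'K x) -fg fK.
subst g g'; congr Homeo; exact: Prop_irrelevance.
Qed.

HB.instance Definition _ := gen_eqMixin (homeo X).
HB.instance Definition _ := gen_choiceMixin (homeo X).

Fact continuous_idmap : continuous (id : X -> X).
Proof. by move=> x. Qed.

Definition homeo_id : homeo X :=
  @Homeo X id id (fun=> erefl) (fun=> erefl)
    continuous_idmap continuous_idmap.

Fact comp_continuous (u v : X -> X) :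
  continuous u -> continuous v -> continuous (u \o v).
Proof. by move=> uc vc x; apply: continuous_comp; [exact: vc|exact: uc]. Qed.

Definition homeo_comp f g : homeo X :=
  @Homeo X (f \o g) (homeo_inv g \o homeo_inv f)
    (can_comp (@homeo_funK _ f) (@homeo_funK _ g))
    (can_comp (@homeo_invK _ g) (@homeo_invK _ f))
    (comp_continuous (@homeo_continuous _ f) (@homeo_continuous _ g))
    (comp_continuous (@homeo_inv_continuous _ g) (@homeo_inv_continuous _ f)).

Definition homeo_sym f : homeo X :=
  @Homeo X (homeo_inv f) f (@homeo_invK _ f) (@homeo_funK _ f)
    (@homeo_inv_continuous _ f) (@homeo_continuous _ f).

Fact homeo_compA : associative homeo_comp.
Proof. by move=> f g h; apply: homeo_eq. Qed.
Fact homeo_comp1f : left_id homeo_id homeo_comp.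
Proof. by move=> f; apply: homeo_eq. Qed.
Fact homeo_compf1 : right_id homeo_id homeo_comp.
Proof. by move=> f; apply: homeo_eq. Qed.
Fact homeo_compVf : left_inverse homeo_id homeo_sym homeo_comp.
Proof. by move=> f; apply: homeo_eq => x /=; rewrite homeo_funK. Qed.
Fact homeo_compfV : right_inverse homeo_id homeo_sym homeo_comp.
Proof. by move=> f; apply: homeo_eq => x /=; rewrite homeo_invK. Qed.

HB.instance Definition _ := isGroup.Build (homeo X)
  homeo_compA homeo_comp1f homeo_compf1 homeo_compVf homeo_compfV.

End HomeoGroup.

Record top_action (Gam : groupType) (X : topologicalType) := TopAction {
  act :> Gam -> X -> X;
  act1 : forall x, act 1%g x = x;
  actM : forall s t x, act (s * t)%g x = act s (act t x);
  act_continuous : forall s, continuous (act s) }.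

Section FullGroup.
Variables (Gam : groupType) (X : topologicalType) (a : top_action Gam X).

Definition topologically_free : Prop :=
  dense [set x | forall s, a s x = x -> s = 1%g].

Definition topological_full_group : set (homeo X) :=
  [set T | exists (n : nat) (P : 'I_n -> set X) (s : 'I_n -> Gam),
    [/\ partition [set: 'I_n] P [set: X],
        forall i, clopen (P i) &
        forall i x, P i x -> T x = a (s i) x]].

(* In {perm T} the product [s * t] applies [s] first, whereas in [homeo X] the
   product is composition; hence the reversed order in the first clause. *)
Definition S3_hom (phi : 'S_3 -> homeo X) : Prop :=
  (forall s t, phi (t * s)%g = (phi s * phi t)%g) /\
  (forall s, topological_full_group (phi s)).

Definition permutes_by_action (phi : 'S_3 -> homeo X) (A : 'I_3 -> set X) :
    Prop :=
  forall s : 'S_3,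
    (forall x, ~ (\bigcup_i A i) x -> phi s x = x) /\
    (forall i, (exists g : Gam, forall x, A i x -> phi s x = a g x) /\
               phi s @` A i = A (s i)).

Definition alternating_generators : set (homeo X) :=
  [set T | exists (phi : 'S_3 -> homeo X) (A : 'I_3 -> set X),
    [/\ S3_hom phi,
        trivIset [set: 'I_3] A,
        forall i, clopen (A i),
        permutes_by_action phi A &
        exists2 s : 'S_3, s \in ('Alt_('I_3))%g & T = phi s]].

Definition alternating_group : set (homeo X) :=
  generated_subgroup alternating_generators.

End FullGroup.

(* Main.v *)
(* Fix a point x with trivial stabilizer.  For distinct s_0, s_1, s_2 in Gam and
   a small clopen set B around x, the sets s_i B are disjoint and the 3-cycle
   c_B(s_0, s_1, s_2) permuting them lies in A(Gam, X).  An element T of the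
   topological full group acts on the orbit of x by T (s x) = h(s) x, where
   h : Gam -> Gam is injective and piecewise a left translation; hence h
   preserves every left-invariant mean m on Gam.  For B small enough,
   T c_B(s_0, s_1, s_2) T^-1 = c_B(h s_0, h s_1, h s_2).  Therefore averaging
   over s_0, s_1 and s_2 with respect to m the ultralimit, as B shrinks to x,
   of the Dirac masses at c_B(s_0, s_1, s_2) gives a conjugation-invariant mean.
   It is atomless because c_B(s_0, s_1, s_2) determines s_2 from s_0, and m has
   no atoms since Gam is infinite. *)
Require Import Defs.
From HB Require Import structures.
From mathcomp Require Import all_boot all_order all_algebra.
From mathcomp Require Import perm alt.
From mathcomp Require Import all_classical all_reals.
From mathcomp Require Import all_analysis.
From mathcomp Require Import lra.

Set Implicit Arguments.
Unset Strict Implicit.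
Unset Printing Implicit Defensive.

Import Order.TTheory GRing.Theory Num.Theory.

Local Open Scope classical_set_scope.
Local Open Scope ring_scope.

(** * Integration against a mean *)

Section MeanTheory.
Variables (R : realType) (T : Type) (m : set T -> R).
Hypothesis m_mean : is_mean m.

Lemma mean_ge0 A : 0 <= m A. Proof. by case: m_mean. Qed.

Lemma meanT : m [set: T] = 1. Proof. by case: m_mean. Qed.

Lemma meanU A B : A `&` B = set0 -> m (A `|` B) = m A + m B.
Proof. by case: m_mean => _ _; apply. Qed.

Lemma mean0 : m set0 = 0.
Proof.
have := @meanU set0 set0 (setI0 _); rewrite setU0 => /eqP.
by rewrite -subr_eq0 opprD addNKr oppr_eq0 => /eqP.
Qed.

Lemma mean_le A B : A `<=` B -> m A <= m B.
Proof.
move=> AB; rewrite -(setDUK AB) meanU ?lerDl ?mean_ge0//.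
by apply/seteqP; split=> t // [? []].
Qed.

Lemma meanC A : m A + m (~` A) = 1.
Proof. by rewrite -meanU ?setICr// setUCr meanT. Qed.

Lemma meanU_eq0 A B : m A = 0 -> m B = 0 -> m (A `|` B) = 0.
Proof.
move=> A0 B0; rewrite -[A `|` B](setDUK (@subsetUl _ A B)) meanU; last first.
  by apply/seteqP; split=> t // [? []].
rewrite A0 add0r; apply/eqP; rewrite eq_le mean_ge0 andbT -B0.
by apply: mean_le => t [[]].
Qed.

Lemma mean_finite A : (forall t, m [set t] = 0) -> finite_set A -> m A = 0.
Proof.
move=> m1 /finite_setP [n]; elim: n A => [|n IH] A.
  by rewrite II0 card_eq0 => /eqP ->; exact: mean0.
move=> /eq_cardSP [t At /IH At0].
by rewrite -(setD1K At) meanU_eq0.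
Qed.

Lemma mean_fiber (K : finType) (f : T -> K) A :
  m A = \sum_(k : K) m (A `&` f @^-1` [set k]).
Proof.
suff H (r : seq K) : uniq r ->
    m (A `&` [set t | f t \in r]) = \sum_(k <- r) m (A `&` f @^-1` [set k]).
  rewrite -[RHS]big_enum -H ?enum_uniq//; congr m.
  by apply/seteqP; split=> t /= => [At|[]//]; rewrite mem_enum.
elim: r => [_|k r IH /= /andP [kr /IH rE]]; first last.
  rewrite big_cons -rE -meanU; first last.
    by apply/seteqP; split=> t //= [[_ ->] [_]]; rewrite (negPf kr).
  congr m; apply/seteqP; split=> t /=.
    by rewrite inE => -[At /orP [/eqP ->|]]; [left|right].
  by move=> [[At ->]|[At ftr]]; rewrite inE ?eqxx// ftr orbT.
by rewrite big_nil -[RHS]mean0; congr m; apply/seteqP; split=> t // [].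
Qed.

(** A simple function is encoded as [v \o f] with [f] valued in a finite type; two of them then have
    a common refinement indexed by the product of the types. *)
Definition simple_integral (K : finType) (f : T -> K) (v : K -> R) : R :=
  \sum_(k : K) v k * m (f @^-1` [set k]).

Lemma simple_integral_refine (K L : finType) (f : T -> K) (g : T -> L) v :
  simple_integral f v =
  \sum_k \sum_l v k * m (f @^-1` [set k] `&` g @^-1` [set l]).
Proof.
by apply: eq_bigr => k _; rewrite (mean_fiber g) mulr_sumr.
Qed.

Lemma simple_integral_refiner (K L : finType) (f : T -> K) (g : T -> L) v :
  simple_integral g v =
  \sum_k \sum_l v l * m (f @^-1` [set k] `&` g @^-1` [set l]).
Proof.
rewrite (simple_integral_refine g f) exchange_big.
by apply: eq_bigr => k _; apply: eq_bigr => l _; rewrite setIC.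
Qed.

Lemma simple_integral_addc (K : finType) (f : T -> K) v c :
  simple_integral f (fun k => v k + c) = simple_integral f v + c.
Proof.
rewrite /simple_integral; under eq_bigr do rewrite mulrDl.
rewrite big_split/= -mulr_sumr; congr (_ + _).
have := mean_fiber f [set: T]; rewrite meanT.
by under eq_bigr do rewrite setTI; move=> <-; rewrite mulr1.
Qed.

Lemma simple_integral_le (K L : finType) (f : T -> K) (g : T -> L) v w c :
  (forall t, v (f t) <= w (g t) + c) ->
  simple_integral f v <= simple_integral g w + c.
Proof.
move=> vw; rewrite -simple_integral_addc (simple_integral_refine f g).
rewrite (simple_integral_refiner f g); apply: ler_sum => k _.
apply: ler_sum => l _.
(* On an empty cell [v k] and [w l] are unrelated, but the cell has mean 0; on any other cell the
   hypothesis is read off at a point. *)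
have [->|/set0P [t [/= fk gl]]] :=
  eqVneq (f @^-1` [set k] `&` g @^-1` [set l]) set0.
  by rewrite mean0 !mulr0.
by apply: ler_wpM2r; [exact: mean_ge0 | rewrite -fk -gl].
Qed.

Lemma simple_integralD (K L : finType) (f : T -> K) (g : T -> L) v w :
  simple_integral (fun t => (f t, g t)) (fun p => v p.1 + w p.2) =
  simple_integral f v + simple_integral g w.
Proof.
rewrite (simple_integral_refine f g) (simple_integral_refiner f g w).
rewrite -big_split/= /simple_integral.
rewrite (eq_bigr (fun p : K * L => (v p.1 + w p.2) *
  m (f @^-1` [set p.1] `&` g @^-1` [set p.2]))); last first.
  move=> [k l] _ /=; congr (_ * m _).
  by apply/seteqP; split=> t /= [-> ->].
rewrite -(pair_bigA _ (fun k l => (v k + w l) *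
  m (f @^-1` [set k] `&` g @^-1` [set l])))/=.
apply: eq_bigr => k _; rewrite -big_split/=.
by apply: eq_bigr => l _; rewrite mulrDl.
Qed.

Definition lower_sums (f : T -> R) : set R :=
  [set r | exists (K : finType) (g : T -> K) (v : K -> R),
    (forall t, v (g t) <= f t) /\ r = simple_integral g v].

Definition mean_integral (f : T -> R) : R := sup (lower_sums f).

Lemma simple_integral_cst c : simple_integral (fun=> tt) (fun=> c) = c.
Proof.
rewrite /simple_integral (big_pred1 tt); last by case.
by rewrite (_ : _ @^-1` _ = setT) ?meanT ?mulr1//; apply/seteqP; split.
Qed.

(** Reduces identities between integrals to simple functions: a uniform approximation within [c]
    fixes the integral up to [c]. *)
Lemma mean_integral_approx (K : finType) (g : T -> K) v f c :
  (forall t, v (g t) <= f t) -> (forall t, f t <= v (g t) + c) ->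
  simple_integral g v <= mean_integral f <= simple_integral g v + c.
Proof.
move=> vf fv; have ub : ubound (lower_sums f) (simple_integral g v + c).
  move=> _ [L [h [w [wf ->]]]]; apply: simple_integral_le => t.
  exact: le_trans (wf t) (fv t).
have inh : lower_sums f (simple_integral g v) by exists K, g, v.
apply/andP; split; last by apply: ge_sup => //; exists (simple_integral g v).
by apply: ub_le_sup => //; exists (simple_integral g v + c).
Qed.

Lemma mean_integral_cst c : mean_integral (fun=> c) = c.
Proof.
have := @mean_integral_approx _ (fun=> tt) (fun=> c) (fun=> c) 0.
rewrite simple_integral_cst addr0 => H.
by apply/eqP; rewrite eq_le andbC; apply: H => t; rewrite ?addr0.
Qed.

Definition unit_valued (f : T -> R) := forall t, 0 <= f t <= 1.

Lemma simple_approx (f : T -> R) e : unit_valued f -> 0 < e ->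
  exists (K : finType) (g : T -> K) (v : K -> R),
    (forall t, v (g t) <= f t) /\ (forall t, f t <= v (g t) + e).
Proof.
(* Round [f t] down to a multiple of [1/n], where [n > 1/e]; the value [f t = 1] has index [n],
   whence the type ['I_n.+1]. *)
move=> f01 e0; pose n := (Num.truncn e^-1).+1.
have n0 : 0 < n%:R :> R by rewrite ltr0n.
have ne : n%:R^-1 < e.
  by rewrite invf_plt ?posrE// truncnS_gt.
exists 'I_n.+1, (fun t => inord (Num.truncn (f t * n%:R))),
  (fun k : 'I_n.+1 => (k : nat)%:R / n%:R).
have fn0 t : 0 <= f t * n%:R.
  by case/andP: (f01 t) => f0 _; rewrite mulr_ge0// ltW.
have tn t : (Num.truncn (f t * n%:R) < n.+1)%N.
  rewrite ltnS -(ler_nat R) (@le_trans _ _ (f t * n%:R))//.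
    by rewrite truncn_le.
  by case/andP: (f01 t) => _ f1; rewrite ler_piMl// ltW.
split=> t; rewrite inordK//.
  by rewrite ler_pdivrMr// truncn_le.
apply: (@le_trans _ _ ((Num.truncn (f t * n%:R)).+1%:R / n%:R)).
  by rewrite ler_pdivlMr// ltW// truncnS_gt.
by rewrite -natr1 mulrDl lerD2l mul1r ltW.
Qed.

Lemma mean_integral_ge0 f : unit_valued f -> 0 <= mean_integral f.
Proof.
move=> f01; have [K [g [v [vf fv]]]] := simple_approx f01 ltr01.
apply: (@le_trans _ _ (simple_integral (fun=> tt) (fun=> 0))).
  by rewrite simple_integral_cst.
(* The constant 0 is a lower simple function; [sup] dominates its integral because the lower sums
   are bounded above, by 1. *)
apply: ub_le_sup; last first.
  by exists unit, (fun=> tt), (fun=> 0); split=> // t; case/andP: (f01 t).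
exists 1 => _ [L [h [w [wf ->]]]].
rewrite -[1](simple_integral_cst) -[leRHS]addr0.
apply: simple_integral_le => t; rewrite addr0 (le_trans (wf t))//.
by case/andP: (f01 t).
Qed.

Lemma mean_integralD f g : unit_valued f -> unit_valued g ->
  mean_integral (fun t => f t + g t) = mean_integral f + mean_integral g.
Proof.
move=> f01 g01; apply/eqP; rewrite -subr_eq0 -normr_le0.
apply/ler_addgt0Pl => e e0.
rewrite addr0; have e2 : 0 < e / 2 by rewrite divr_gt0.
have [K [f' [v [vf fv]]]] := simple_approx f01 e2.
have [L [g' [w [wg gw]]]] := simple_approx g01 e2.
have /andP [f1 f2] := mean_integral_approx vf fv.
have /andP [g1 g2] := mean_integral_approx wg gw.
have /andP [] := @mean_integral_approx _ (fun t => (f' t, g' t))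
  (fun p => v p.1 + w p.2) (fun t => f t + g t) e
  (fun t => lerD (vf t) (wg t))
  (fun t => ltac:(have := fv t; have := gw t; rewrite /=; lra)).
by rewrite simple_integralD ler_norml; lra.
Qed.

(** For simple [g], the fibers of [g \o h] have the same means as those of [g]; uniform
    approximation carries this over to [f]. *)
Lemma mean_integral_comp (h : T -> T) f :
  (forall A, m (h @^-1` A) = m A) -> unit_valued f ->
  mean_integral (f \o h) = mean_integral f.
Proof.
move=> mh f01; apply/eqP; rewrite -subr_eq0 -normr_le0.
apply/ler_addgt0Pl => e e0.
rewrite addr0; have [K [g [v [vf fv]]]] := simple_approx f01 e0.
have := mean_integral_approx vf fv.
have := @mean_integral_approx _ (g \o h) v (f \o h) e
  (fun t => vf (h t)) (fun t => fv (h t)).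
have -> : simple_integral (g \o h) v = simple_integral g v.
  by apply: eq_bigr => k _; rewrite comp_preimage mh.
by move=> /andP [a1 a2] /andP [b1 b2]; rewrite ler_norml; lra.
Qed.

Lemma mean_integral_null f A : m A = 0 -> unit_valued f ->
  (forall t, ~ A t -> f t = 0) -> mean_integral f = 0.
Proof.
move=> A0 f01 fA; apply/eqP; rewrite eq_le mean_integral_ge0// andbT.
apply: ge_sup.
  exists (simple_integral (fun=> tt) (fun=> 0)), unit, (fun=> tt), (fun=> 0).
  by split=> // t; case/andP: (f01 t).
move=> _ [K [g [v [vf ->]]]].
(* The bound 0 is rewritten as the integral of the indicator function of [A], which dominates
   [f]. *)
have <- : simple_integral (fun t => `[< A t >]) (fun b : bool => b%:R) = 0.
  rewrite /simple_integral big_bool/= mul0r addr0 mul1r -[RHS]A0; congr m.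
  by apply/seteqP; split=> t /= /asboolP.
rewrite -[leRHS]addr0; apply: simple_integral_le => t; rewrite addr0.
apply: (le_trans (vf t)); case: asboolP => [_|/fA ->//].
by case/andP: (f01 t).
Qed.

End MeanTheory.

(** * Averages of means and limits of Dirac masses *)

Lemma mean_unit_valued (R : realType) (S T : Type) (k : S -> set T -> R) A :
  (forall s, is_mean (k s)) -> unit_valued (fun s => k s A).
Proof.
move=> kmean s; rewrite (mean_ge0 (kmean s)) -(meanT (kmean s)).
exact: (mean_le (kmean s)).
Qed.

Definition mean_bind (R : realType) (S T : Type) (m : set S -> R)
  (k : S -> set T -> R) (A : set T) : R := mean_integral m (fun s => k s A).

Lemma mean_bind_mean (R : realType) (S T : Type) (m : set S -> R)
    (k : S -> set T -> R) :
  is_mean m -> (forall s, is_mean (k s)) -> is_mean (mean_bind m k).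
Proof.
move=> mmean kmean; split=> [A||A B AB].
- by apply: mean_integral_ge0 => //; exact: mean_unit_valued.
- rewrite /mean_bind (_ : (fun s => _) = fun=> 1) ?mean_integral_cst//.
  by apply/funext => s; rewrite meanT.
rewrite /mean_bind -mean_integralD; do ?[exact: mean_unit_valued|by []].
by congr mean_integral; apply/funext => s; rewrite meanU.
Qed.

Lemma mean_bind_null (R : realType) (S T : Type) (m : set S -> R)
    (k : S -> set T -> R) A N :
  is_mean m -> (forall s, is_mean (k s)) -> m N = 0 ->
  (forall s, ~ N s -> k s A = 0) -> mean_bind m k A = 0.
Proof.
move=> mmean kmean N0 kA; apply: mean_integral_null N0 _ _ => //.
exact: mean_unit_valued.
Qed.

(** The limit along [U] of the Dirac masses at the points [f i]; for an ultrafilter every set gets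
    the limit 0 or 1. *)
Definition ultra_mean (R : realType) (I T : Type) (U : set_system I)
  (f : I -> T) (A : set T) : R := (`[< U (f @^-1` A) >])%:R.

Lemma ultra_mean_mean (R : realType) (I T : Type) (U : set_system I)
    (f : I -> T) : UltraFilter U -> is_mean (ultra_mean R U f).
Proof.
move=> UU; split=> [A||A B AB]; rewrite /ultra_mean.
- exact: ler0n.
- by rewrite asboolT//; exact: filterT.
have [UA|nUA] := pselect (U (f @^-1` A)).
  rewrite (asboolT UA) asboolT; last by apply: filterS UA => i; left.
  rewrite asboolF ?addr0// => UB; have [i [Ai Bi]] := filter_ex (filterI UA UB).
  by have : (A `&` B) (f i) by []; rewrite AB.
rewrite (asboolF nUA) add0r; congr (_ %:R); congr nat_of_bool.
apply: asbool_equiv_eq; split=> [UAB|]; last by apply: filterS => i; right.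
have [//|UnA] := in_ultra_setVsetC (f @^-1` A) UU.
by apply: filterS (filterI UAB UnA) => i [[]].
Qed.

Lemma ultra_mean_eq (R : realType) (I T : Type) (U : set_system I)
    (f g : I -> T) (A B : set T) : UltraFilter U ->
  (\near U, A (f U) <-> B (g U)) -> ultra_mean R U f A = ultra_mean R U g B.
Proof.
move=> UU AB; congr (_ %:R); congr nat_of_bool.
by apply: asbool_equiv_eq; split; apply: filterS2 AB => i [].
Qed.

(** Change of variable [s] to [h s]. In a nested average it passes from the outer means to the inner
    ones, one variable at a time. *)
Lemma mean_bind_invariant (R : realType) (S T : Type) (m : set S -> R)
    (k k' : S -> set T -> R) (h : S -> S) A B :
  is_mean m -> (forall s, is_mean (k s)) ->
  (forall C, m (h @^-1` C) = m C) -> (forall s, k' s A = k (h s) B) ->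
  mean_bind m k' A = mean_bind m k B.
Proof.
move=> mmean kmean mh kk'; rewrite /mean_bind.
rewrite -(mean_integral_comp mmean mh (mean_unit_valued B kmean)).
by congr mean_integral; apply/funext => s; rewrite kk'.
Qed.

(** All points have the same mass [p] by translation, and [n] distinct points give [n p <= 1], which
    fails for [p > 0] and [n > 1/p]. *)
Lemma invariant_mean_set1 (R : realType) (H : groupType) (m : set H -> R) :
  infinite_set [set: H] -> is_mean m ->
  (forall (g : H) (A : set H), m [set (g * x)%g | x in A] = m A) ->
  forall g, m [set g] = 0.
Proof.
move=> infH mmean inv g.
have mg h : m [set h] = m [set g].
  by rewrite -(inv (h * g^-1)%g [set g]) image_set1 mulgVK.
have card n : exists2 F : set H, finite_set F & m F = n%:R * m [set g].
  elim: n => [|n [F finF mF]]; first by exists set0; rewrite ?mul0r ?mean0.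
  have [h Fh] : exists h, ~ F h.
    apply: contrapT => nF; apply: infH; apply: sub_finite_set finF => h _.
    by apply: contrapT => Fh; apply: nF; exists h.
  exists (F `|` [set h]); first by rewrite finite_setU; split.
  rewrite meanU ?mF ?mg -?natr1 ?mulrDl ?mul1r//.
  by apply/seteqP; split=> // u [Fu uh]; apply: Fh; rewrite -uh.
apply/eqP; rewrite eq_le mean_ge0// andbT leNgt; apply/negP => p0.
have [F _ mF] := card (Num.truncn (m [set g])^-1).+1.
have : m F <= 1 by rewrite -(meanT mmean); exact: mean_le.
by rewrite mF leNgt -ltr_pdivrMr// div1r truncnS_gt.
Qed.

(** * Permuting translates of a clopen set *)

Section Towers.
Variables (Gam : groupType) (X : topologicalType) (a : top_action Gam X).

Lemma actK s : cancel (a s) (a s^-1%g).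
Proof. by move=> x; rewrite -actM mulVg act1. Qed.

Lemma actKV s : cancel (a s^-1%g) (a s).
Proof. by move=> x; rewrite -actM mulgV act1. Qed.

(* [partition] forbids empty blocks; here the [P i] may be empty. *)
Lemma full_groupP (T : homeo X) (I : finType) (P : I -> set X) (s : I -> Gam) :
  \bigcup_i P i = setT -> trivIset setT P -> (forall i, clopen (P i)) ->
  (forall i x, P i x -> T x = a (s i) x) -> topological_full_group a T.
Proof.
move=> covP trivP clP TP; pose D := [set i | `[< P i !=set0 >]]%SET.
exists #|D|, (fun i => P (enum_val i)), (fun i => s (enum_val i)); split=> //.
- split.
  + apply/seteqP; split=> // x _.
    have [i _ Pix] : (\bigcup_i P i) x by rewrite covP.
    have iD : i \in D by rewrite inE; apply/asboolP; exists x.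
    by exists (enum_rank_in iD i) => //=; rewrite enum_rankK_in.
  + move=> i j _ _ Pij; apply: enum_val_inj; exact: trivP Pij.
  + by move=> i _; have := enum_valP i; rewrite inE => /asboolP.
- by move=> i x /TP.
Qed.

(* The translate [g i B]. *)
Definition level (B : set X) (g : 'I_3 -> Gam) (i : 'I_3) : set X :=
  a (g i)^-1%g @^-1` B.

(** The level containing [y] is found by [pick], so the map is defined for all [B] and [g]; the
    choice is unambiguous once the levels are disjoint. *)
Definition tower_map (B : set X) (g : 'I_3 -> Gam) (s : 'S_3) (y : X) : X :=
  if [pick i | `[< level B g i y >]] is Some i
  then a (g (s i)) (a (g i)^-1%g y) else y.

Lemma tower_map_out B g s y :
  (forall i, ~ level B g i y) -> tower_map B g s y = y.
Proof.
by rewrite /tower_map; case: pickP => // i /asboolP Liy /(_ i).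
Qed.

Section Tower.
Variables (B : set X) (g : 'I_3 -> Gam).
Hypotheses (trivB : trivIset setT (level B g)) (clB : clopen B).
Implicit Types s t : 'S_3.

Lemma tower_map_in s i y : level B g i y ->
  tower_map B g s y = a (g (s i)) (a (g i)^-1%g y).
Proof.
move=> Liy; rewrite /tower_map; case: pickP => [j /asboolP Ljy|/(_ i)].
  by rewrite (trivB (I : setT j) (I : setT i))//; exists y.
by move/asboolP.
Qed.

Lemma tower_map_level s i y : level B g i y ->
  level B g (s i) (tower_map B g s y).
Proof. by move=> Liy; rewrite (tower_map_in s Liy) /level/= actK. Qed.

Lemma tower_mapM s t y : tower_map B g (t * s)%g y =
  tower_map B g s (tower_map B g t y).
Proof.
have [[i Liy]|nL] := pselect (exists i, level B g i y).
  rewrite (tower_map_in s (tower_map_level t Liy)) !(tower_map_in _ Liy).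
  by rewrite permM actK.
have {}nL i : ~ level B g i y by move=> Liy; apply: nL; exists i.
by rewrite !tower_map_out.
Qed.

Lemma tower_map1 y : tower_map B g 1%g y = y.
Proof.
have [[i Liy]|nL] := pselect (exists i, level B g i y).
  by rewrite (tower_map_in _ Liy) perm1 actKV.
by rewrite tower_map_out// => i Liy; apply: nL; exists i.
Qed.

Lemma level_clopen i : clopen (level B g i).
Proof. by apply: preimage_clopen => //; exact: act_continuous. Qed.

Lemma levels_clopen : clopen (\bigcup_i level B g i).
Proof.
split; first by apply: bigcup_open => i _; case: (level_clopen i).
apply: closed_bigcup => [|i _]; first exact: finite_finset.
by case: (level_clopen i).
Qed.

(** The levels and the complement of their union are open, and on each of them the map is the action
    of one group element. *)
Lemma tower_map_continuous s : continuous (tower_map B g s).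
Proof.
move=> y; have [[i Liy]|nL] := pselect (exists i, level B g i y).
  have E z : level B g i z -> tower_map B g s z = a (g (s i) * (g i)^-1)%g z.
    by move=> /(tower_map_in s) ->; rewrite actM.
  rewrite /continuous_at E//.
  apply: cvg_trans (@act_continuous _ _ a (g (s i) * (g i)^-1)%g y).
  apply: near_eq_cvg; have [oL _] := level_clopen i.
  by apply: filterS (open_nbhs_nbhs (conj oL Liy)) => z /E.
have E z : (~` \bigcup_i level B g i) z -> tower_map B g s z = z.
  by move=> nLz; rewrite tower_map_out// => i Lz; apply: nLz; exists i.
have Ly : (~` \bigcup_i level B g i) y by move=> [i _ Liy]; apply: nL; exists i.
rewrite /continuous_at E//.
apply: cvg_trans (_ : id @ y --> y); last exact: cvg_id.
apply: near_eq_cvg; have [_ /closed_openC oL] := levels_clopen.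
by apply: filterS (open_nbhs_nbhs (conj oL Ly)) => z /E.
Qed.

Lemma tower_mapK s : cancel (tower_map B g s) (tower_map B g s^-1%g).
Proof. by move=> y; rewrite -tower_mapM mulgV tower_map1. Qed.

Lemma tower_mapKV s : cancel (tower_map B g s^-1%g) (tower_map B g s).
Proof. by move=> y; rewrite -tower_mapM mulVg tower_map1. Qed.

Definition tower_homeo s : homeo X :=
  Homeo (tower_mapK s) (tower_mapKV s)
    (@tower_map_continuous s) (@tower_map_continuous s^-1%g).

Lemma tower_homeo_full s : topological_full_group a (tower_homeo s).
Proof.
(* [None] indexes the complement of the levels, where the group element is 1. *)
pose P (o : option 'I_3) := if o is Some i then level B g i
  else ~` \bigcup_i level B g i.
apply: (@full_groupP _ _ P
  (fun o => if o is Some i then (g (s i) * (g i)^-1)%g else 1%g)).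
- apply/seteqP; split=> // y _.
  have [[i _ Liy]|nL] := pselect ((\bigcup_i level B g i) y).
    by exists (Some i).
  by exists None.
- move=> [i|] [j|] _ _ [y [/= Py Qy]]//.
  + by congr Some; apply: trivB => //; exists y.
  + by case: Qy; exists i.
  + by case: Py; exists j.
- case=> [i|] /=; first exact: level_clopen.
  by apply: clopenC => //; exact: levels_clopen.
move=> [i|] y /= Py; first by rewrite actM (tower_map_in s Py).
by rewrite act1 tower_map_out// => i Liy; apply: Py; exists i.
Qed.

(** The family [tower_homeo] is itself a homomorphism as in the definition of the generators, with
    the levels as the sets it permutes. *)
Lemma tower_homeo_alternating s : (s \in 'Alt_('I_3))%g ->
  alternating_group a (tower_homeo s).
Proof.
move=> sA; apply: sub_gen_smallest; exists tower_homeo, (level B g); split=> //.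
- split=> [t u|t]; last exact: tower_homeo_full.
  by apply: homeo_eq => y /=; rewrite tower_mapM.
- exact: level_clopen.
- move=> t; split=> [y nL|i].
    by rewrite /= tower_map_out// => i Liy; apply: nL; exists i.
  split.
    exists (g (t i) * (g i)^-1)%g => y Liy.
    by rewrite /= (tower_map_in t Liy) actM.
  apply/seteqP; split=> [_ [y Liy <-]|y Ltiy]; first exact: tower_map_level.
  exists (tower_map B g t^-1%g y); last by rewrite /= tower_mapKV.
  by have := tower_map_level t^-1%g Ltiy; rewrite permK.
by exists s.
Qed.

End Tower.
End Towers.

(** * The conjugation-invariant mean of a free orbit *)

Section FreeOrbit.
Variables (Gam : groupType) (X : topologicalType) (a : top_action Gam X).
Variables (x : X) (G : groupClosed (homeo X)).
Hypotheses (zdimX : zero_dimensional X).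
Hypothesis free_x : forall s, a s x = x -> s = 1%g.
Hypothesis G_full : [set` G] `<=` topological_full_group a.
Hypothesis alt_G : alternating_group a `<=` [set` G].

Lemma free_orbit_inj s t : a s x = a t x -> s = t.
Proof.
move=> /(congr1 (a t^-1%g)); rewrite actK -actM => /free_x.
by move=> /(congr1 (fun u => t * u)%g); rewrite mulVKg mulg1.
Qed.

(** A filter on subsets of [X] rather than on points: along it, clopen neighborhoods [B] shrink to
    [x]. *)
Definition small_clopen : set_system (set X) :=
  filter_from [set V | clopen V /\ V x]
    (fun V => [set B | [/\ clopen B, B x & B `<=` V]]).

Lemma small_clopen_proper : ProperFilter small_clopen.
Proof.
apply: filter_from_proper => [|V [clV Vx]]; last by exists V; split.
apply: filter_from_filter => [|V W [clV Vx] [clW Wx]].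
  by exists setT; split=> //; exact: clopenT.
exists (V `&` W); first by split=> //; exact: clopenI.
by move=> B [clB Bx BVW]; split=> /=; split=> // y /BVW [].
Qed.
#[local] Existing Instance small_clopen_proper.

Lemma near_small_clopen V : clopen V -> V x ->
  \forall B \near small_clopen, [/\ clopen B, B x & B `<=` V].
Proof. by move=> clV Vx; exists V. Qed.

(** Freeness makes the points [g i x] distinct, clopen sets separate them, and a small [B] keeps
    each level on its side. *)
Lemma near_trivIset_level (g : 'I_3 -> Gam) : injective g ->
  \forall B \near small_clopen, trivIset setT (level a B g).
Proof.
move=> gI.
have H (i j : 'I_3) : i != j -> \forall B \near small_clopen,
    level a B g i `&` level a B g j = set0.
  move=> ij; have gij : a (g i) x != a (g j) x.
    by apply: contra_neq ij => /free_orbit_inj /gI.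
  have [W [clW Wi Wj]] := zdimX gij.
  have clWi : clopen (a (g i) @^-1` W).
    by apply: preimage_clopen => //; exact: act_continuous.
  have clWj : clopen (a (g j) @^-1` (~` W)).
    by apply: preimage_clopen; [exact: clopenC|exact: act_continuous].
  apply: filterS2 (near_small_clopen clWi Wi) (near_small_clopen clWj Wj).
  move=> B [_ _ Bi] [_ _ Bj]; apply/seteqP; split=> // y [/= /Bi Ly /Bj].
  by rewrite /= !actKV in Ly *.
have : \forall B \near small_clopen, forall i j : 'I_3, i != j ->
    level a B g i `&` level a B g j = set0.
  apply: filter_forall => i; apply: filter_forall => j.
  have [->|ij] := eqVneq i j; first by apply: filterE => B /eqP.
  by apply: filterS (H _ _ ij) => B ->.
by apply: filterS => B LB; apply/trivIsetP => i j _ _ /LB.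
Qed.

(** The left factor acts first, so this is the cycle sending 0 to 2, 2 to 1 and 1 to 0. *)
Definition cycle3 : 'S_3 := (tperm ord0 (inord 1) * tperm (inord 1) ord_max)%g.

Lemma cycle3_even : (cycle3 \in 'Alt_('I_3))%g.
Proof.
rewrite Alt_even odd_permM !odd_tperm.
by rewrite -!val_eqE /= inordK.
Qed.

Lemma cycle3_0 : cycle3 ord0 = ord_max.
Proof. by rewrite permM !tpermL. Qed.

(* Equal to 1 when [g] is not injective, which makes the equivariance
   [tower_cycle_conj] hold for all [g]. *)
Definition tower_cycle (g : 'I_3 -> Gam) (B : set X) : subgroup_type G :=
  xget 1%g [set u : subgroup_type G |
              injective g /\ (val u : homeo X) =1 tower_map a B g cycle3].

Lemma tower_cycle_not_inj g B : ~ injective g -> tower_cycle g B = 1%g.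
Proof. by move=> gNI; apply: xgetPN => u []. Qed.

(** A 3-cycle is even, so [alt_G] supplies the element that [xget] looks for. *)
Lemma tower_cycleE g B :
  injective g -> clopen B -> trivIset setT (level a B g) ->
  (val (tower_cycle g B) : homeo X) =1 tower_map a B g cycle3.
Proof.
move=> gI clB trivB.
pose u := tower_homeo trivB clB cycle3.
have uG : u \in G.
  by apply: (alt_G (t := u)); exact: tower_homeo_alternating cycle3_even.
rewrite /tower_cycle; case: xgetP => [v -> [] //|/(_ (exist _ u uG))] [].
by [].
Qed.

Lemma near_tower_cycleE g : injective g -> \forall B \near small_clopen,
  [/\ B x, trivIset setT (level a B g) &
      (val (tower_cycle g B) : homeo X) =1 tower_map a B g cycle3].
Proof.
move=> gI.
apply: filterS2 (near_small_clopen clopenT I) (near_trivIset_level gI).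
by move=> B [clB Bx _] trivB; split=> //; exact: tower_cycleE.
Qed.

(** * The full group acting on the free orbit, read on [Gam] *)

Definition orbit_map (T : homeo X) (h : Gam -> Gam) : Prop :=
  forall s, T (a s x) = a (h s) x.

Lemma orbit_map_inj T h : orbit_map T h -> injective h.
Proof.
move=> Th s t hst; apply: free_orbit_inj; apply: (can_inj (@homeo_funK _ T)).
by rewrite !Th hst.
Qed.

(** [T] acts as a single [r i] on the clopen piece containing [s x]; freeness gives [h s = r i * s],
    and [s B] stays in that piece for small [B]. *)
Lemma near_orbit_map T h s : topological_full_group a T -> orbit_map T h ->
  \forall B \near small_clopen, forall y, B y -> T (a s y) = a (h s) y.
Proof.
move=> [n [P [r [[covP _ _] clP TP]]]] Th.
have [i _ Pisx] : cover setT P (a s x) by rewrite covP.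
have hs : h s = (r i * s)%g by apply: free_orbit_inj; rewrite -Th (TP i)// actM.
have clPi : clopen (a s @^-1` P i).
  by apply: preimage_clopen => //; exact: act_continuous.
apply: filterS (near_small_clopen clPi Pisx) => B [_ _ BP] y /BP Py.
by rewrite (TP i)// hs actM.
Qed.

Lemma tower_cycle_conj (t : subgroup_type G) h g : orbit_map (val t) h ->
  \forall B \near small_clopen,
    tower_cycle (h \o g) B = (t * tower_cycle g B * t^-1)%g.
Proof.
move=> th; have hI := orbit_map_inj th.
(* If [g] is not injective, neither is [h \o g], and both cycles are 1 by convention. *)
have [gI|gNI] := pselect (injective g); last first.
  apply: filterE => B; rewrite !tower_cycle_not_inj ?mulg1 ?mulgV// => hgI.
  by apply: gNI => i j gij; apply: hgI; rewrite /= gij.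
have hgI : injective (h \o g) by exact: inj_comp.
have tfull : topological_full_group a (val t) by apply: G_full; exact: (valP t).
have near_t : \forall B \near small_clopen, forall i y, B y ->
    (val t : homeo X) (a (g i) y) = a (h (g i)) y.
  by apply: filter_forall => i; exact: near_orbit_map tfull th.
near=> B.
have [clB _ _] : [/\ clopen B, B x & B `<=` setT].
  by near: B; exact: near_small_clopen clopenT I.
have trivg : trivIset setT (level a B g) by near: B; exact: near_trivIset_level.
have trivhg : trivIset setT (level a B (h \o g)).
  by near: B; exact: near_trivIset_level.
have tB : forall i y, B y -> (val t : homeo X) (a (g i) y) = a (h (g i)) y.
  by near: B.
(* [t] carries each level of [g] onto the corresponding level of [h \o g]. *)
have level_t i y : level a B (h \o g) i y <->
    level a B g i (homeo_inv (val t) y).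
  split=> Ly.
    by rewrite /level/= -{1}(actKV a (h (g i)) y) -tB// homeo_funK actK.
  have := tB i _ Ly; rewrite actKV homeo_invK => yE.
  by rewrite /level/= yE actK.
apply: val_inj; apply: homeo_eq => y.
rewrite tower_cycleE//.
have -> : (val (t * tower_cycle g B * t^-1)%g : homeo X) y =
    (val t : homeo X) ((val (tower_cycle g B) : homeo X) (homeo_inv (val t) y)).
  by [].
rewrite tower_cycleE//.
have [[i Ly]|nL] := pselect (exists i, level a B (h \o g) i y).
  have Lty := (level_t i y).1 Ly.
  rewrite (tower_map_in trivhg _ Ly) (tower_map_in trivg _ Lty) tB//=.
  (* It remains that [y] and its preimage under [t] lie over the same point of [B], in level [i] of
     [h \o g] and of [g] respectively. *)
  congr (a _ _); rewrite -[y in LHS](homeo_invK (val t)).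
  by rewrite -[homeo_inv (val t) y in LHS](actKV a (g i)) tB// actK.
rewrite !tower_map_out ?homeo_invK// => i.
  by move=> /level_t Ly; apply: nL; exists i.
by move=> Ly; apply: nL; exists i.
Unshelve. all: by end_near.
Qed.

Lemma orbit_map_exists T : topological_full_group a T ->
  exists h, orbit_map T h.
Proof.
move=> [n [P [r [[covP _ _] _ TP]]]].
suff /choice [h hE] : forall s, exists u, T (a s x) = a u x by exists h.
move=> s; have [i _ Pisx] : cover setT P (a s x) by rewrite covP.
by exists (r i * s)%g; rewrite (TP i)// actM.
Qed.

(** * Averaging over the orbit *)

Section InvariantMean.
Variables (R : realType) (m : set Gam -> R).
Hypotheses (m_mean : is_mean m).
Hypothesis m_inv : forall g A, m [set (g * u)%g | u in A] = m A.

(** Sorting [s] by the piece containing [s x] cuts [Gam] into finitely many sets, on each of which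
    [h] is a left translation and so preserves [m]. *)
Lemma orbit_map_preimage_le T h : topological_full_group a T -> orbit_map T h ->
  forall A, m (h @^-1` A) <= m A.
Proof.
move=> [n [P [r [[covP _ _] clP TP]]]] Th A; have hI := orbit_map_inj Th.
have /choice [k kP] : forall s, exists i, P i (a s x).
  move=> s; have [i _ Pisx] : cover setT P (a s x) by rewrite covP.
  by exists i.
have hE s : h s = (r (k s) * s)%g.
  by apply: free_orbit_inj; rewrite -Th (TP (k s))// actM.
pose k' u := k (xget 1%g [set s | h s = u]).
have k'h s : k' (h s) = k s.
  by congr k; apply: hI; apply: (xgetPex 1%g (P := [set u | h u = h s]));
    exists s.
(* The translates of the fibers of [k] are disjoint, being the images under [h]
   of disjoint sets; [k'] extends [k \o h^-1] to a function on [Gam]. *)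
rewrite (mean_fiber m_mean k) (mean_fiber m_mean k' A); apply: ler_sum => i _.
rewrite -(m_inv (r i)); apply: mean_le => // _ [s [/= As ks] <-].
by rewrite -ks -hE; split=> //=; rewrite k'h.
Qed.

(** The inequality for the complement of [A] is the reverse inequality for [A], since the total mass
    is 1. *)
Lemma orbit_map_preimage T h : topological_full_group a T -> orbit_map T h ->
  forall A, m (h @^-1` A) = m A.
Proof.
move=> Tfull Th A; have := orbit_map_preimage_le Tfull Th A.
have := orbit_map_preimage_le Tfull Th (~` A); rewrite preimage_setC.
by have := meanC m_mean A; have := meanC m_mean (h @^-1` A); lra.
Qed.

Hypothesis m1 : forall s, m [set s] = 0.

Definition triple (s0 s1 s2 : Gam) : 'I_3 -> Gam := tnth [tuple s0; s1; s2].

Lemma comp_triple (h : Gam -> Gam) s0 s1 s2 :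
  h \o triple s0 s1 s2 = triple (h s0) (h s1) (h s2).
Proof.
apply/funext => -[[|[|[|//]]] lti] /=; by rewrite /triple !(tnth_nth 1%g).
Qed.

Lemma free_orbit_inner_amenable : inner_amenable R (subgroup_type G).
Proof.
have [U [UU small_U]] := ultraFilterLemma small_clopen_proper.
pose nu g := ultra_mean R U (tower_cycle g).
have nu_mean g : is_mean (nu g) by exact: ultra_mean_mean.
pose mu2 s0 s1 := mean_bind m (fun s2 => nu (triple s0 s1 s2)).
have mu2_mean s0 s1 : is_mean (mu2 s0 s1) by exact: mean_bind_mean.
pose mu1 s0 := mean_bind m (mu2 s0).
have mu1_mean s0 : is_mean (mu1 s0) by exact: mean_bind_mean.
have mu_mean : is_mean (mean_bind m mu1) by exact: mean_bind_mean.
exists (mean_bind m mu1); split=> // [t A|F finF].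
  have tfull : topological_full_group a (val t).
    by apply: G_full; exact: (valP t).
  have [h th] := orbit_map_exists tfull.
  have mh := orbit_map_preimage tfull th.
  (* Each of [s0], [s1], [s2] is replaced by its image under [h], which preserves [m]; equivariance
     of the innermost mean remains. *)
  apply/esym; apply: mean_bind_invariant (mh) _ => // s0.
  apply: mean_bind_invariant (mh) _ => // s1.
  apply: mean_bind_invariant (mh) _ => // s2.
  rewrite -comp_triple; apply: ultra_mean_eq; apply: small_U.
  apply: filterS (tower_cycle_conj (triple s0 s1 s2) th) => B ->.
  split=> [Ac|[u Au]]; first by exists (tower_cycle (triple s0 s1 s2) B).
  by move=> /mulIg /mulgI <-.
apply: mean_finite (finF) => // u; apply: (mean_bind_null (N := set0)) => //.
  exact: mean0.
move=> s0 _; apply: (mean_bind_null (N := [set s0])) => // s1 /= s10.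
(* [N] contains the [s2] that repeat [s0] or [s1], and the at most one [s2] with [u (s0 x) = s2 x];
   it is null because points are. *)
pose N := [set s0] `|`
  ([set s1] `|` [set s2 | (val u : homeo X) (a s0 x) = a s2 x]).
apply: (mean_bind_null (N := N)) => // [|s2 Ns2].
  do 2!apply: meanU_eq0 => //.
  have [[s us]|nu0] := pselect (exists s, (val u : homeo X) (a s0 x) = a s x).
    apply/eqP; rewrite eq_le mean_ge0// andbT -(m1 s).
    apply: mean_le => // s' /=.
    by rewrite us => /free_orbit_inj ->.
  rewrite -[RHS](mean0 m_mean); congr m; apply/seteqP; split=> // s us.
  by apply: nu0; exists s.
have gI : injective (triple s0 s1 s2).
  apply/tuple_uniqP; rewrite /= !inE negb_or !andbT; apply/andP; split.
    by apply/andP; split; apply/eqP => E; [apply: s10|apply: Ns2; left].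
  by apply/eqP => E; apply: Ns2; right; left.
(* If [u] had mass 1, it would equal the 3-cycle of some small [B], which sends [s0 x] to [s2 x], so
   [s2] would lie in [N]. *)
rewrite /nu /ultra_mean asboolF// => Uu.
have [B [/= Bu [Bx trivB cE]]] :=
  filter_ex (filterI Uu (small_U _ (near_tower_cycleE gI))).
apply: Ns2; right; right => /=; rewrite -Bu cE.
have L0 : level a B (triple s0 s1 s2) ord0 (a s0 x) by rewrite /level/= actK.
by rewrite (tower_map_in trivB _ L0) cycle3_0 actK.
Qed.

End InvariantMean.
End FreeOrbit.

Theorem corollary6p1 (R : realType) (Gam : groupType)
    (a : top_action Gam cantor_space) (G : groupClosed (homeo cantor_space)) :
  infinite_set [set: Gam] ->
  amenable R Gam ->
  topologically_free a ->
  [set` G] `<=` topological_full_group a ->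
  alternating_group a `<=` [set` G] ->
  inner_amenable R (subgroup_type G).
Proof.
move=> infGam [m [m_mean m_inv]] free_a G_full alt_G.
(* Density, applied to the whole space, gives a point with trivial stabilizer. *)
have [x [_ free_x]] := free_a setT (ex_intro _ point I) openT.
apply: (free_orbit_inner_amenable cantor_zero_dimensional free_x) (m_inv) _ =>
  //.
exact: (invariant_mean_set1 infGam m_mean m_inv).
Qed.
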